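(* Let $k\geq 3$ be an integer. Let $X$ be any connected graph on $n$ vertices that contains the $(k+1)$-legged spider $\mathrm{Spider}(2,2,1,\dots,1)$ (two legs of length $2$ and $k-1$ legs of length $1$) as a subgraph. Let $Y$ be a graph on $n$ vertices whose complement $\overline{Y}$ is a spider with at most $k$ legs. Then the friends-and-strangers graph $\mathrm{FS}(X,Y)$ is connected.
   Context: All graphs are finite and simple, and $[n]=\{1,\dots,n\}$. A subgraph of a graph is a graph whose vertex set and edge set are subsets of those of the original graph (not necessarily induced; containment is up to isomorphism). The complement $\overline{G}$ of a graph $G$ has vertex set $V(G)$, and two distinct vertices are adjacent in $\overline{G}$ iff they are not adjacent in $G$. Friends-and-strangers graph: for graphs $X,Y$ with $V(X)=V(Y)=[n]$, $\mathrm{FS}(X,Y)$ is the graph whose vertices are all permutations $\sigma$ of $[n]$ (viewed as bijections $V(X)\to V(Y)$), where $\sigma$ and $\phi$ are adjacent iff there is an edge $\{a,b\}\in E(X)$ such that $\{\sigma(a),\sigma(b)\}\in E(Y)$, $\sigma(a)=\phi(b)$, $\sigma(b)=\phi(a)$, and $\sigma(c)=\phi(c)$ for all $c\in V(X)\setminus\{a,b\}$. Graphs on $n$ vertices are labelled by $[n]$ in any way; connectedness of $\mathrm{FS}(X,Y)$ does not depend on the labelling. Spider: for positive integers $\lambda_1\geq\cdots\geq\lambda_m$, $\mathrm{Spider}(\lambda_1,\dots,\lambda_m)$ is the graph on $1+\sum_{i=1}^m\lambda_i$ vertices consisting of a center vertex together with $m$ pairwise disjoint paths (legs) having $\lambda_1,\dots,\lambda_m$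 vertices respectively (the lengths of the legs), one endpoint of each leg being joined by an edge to the center (and no other edges). A spider with $m$ legs is a graph of this form. *)

(* Defs.v *)
From mathcomp Require Import all_boot perm.

Set Implicit Arguments.
Unset Strict Implicit.
Unset Printing Implicit Defensive.

Record sgraph (T : finType) := SGraph {
  edge : rel T;
  edge_sym : symmetric edge;
  edge_irr : irreflexive edge
}.

Definition connected_graph (T : finType) (G : sgraph T) : Prop :=
  0 < #|T| /\ forall x y : T, connect (edge G) x y.

Definition graph_iso (T U : finType) (G : sgraph T) (H : sgraph U) : Prop :=
  exists2 f : T -> U, bijective f & forall x y, edge H (f x) (f y) = edge G x y.

(* Containment up to isomorphism of a not necessarily induced subgraph: the
   image of f with the images of the edges of H is the copy of H in G. *)
Definition contains_subgraph (T U : finType) (G : sgraph T) (H : sgraph U) :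
    Prop :=
  exists2 f : U -> T, injective f & forall x y, edge H x y -> edge G (f x) (f y).

Section Complement.
Variables (T : finType) (G : sgraph T).

Definition compl_rel : rel T := fun x y => (x != y) && ~~ edge G x y.

Lemma compl_rel_sym : symmetric compl_rel.
Proof. by move=> x y; rewrite /compl_rel eq_sym edge_sym. Qed.

Lemma compl_rel_irr : irreflexive compl_rel.
Proof. by move=> x; rewrite /compl_rel eqxx. Qed.

Definition compl_graph : sgraph T := SGraph compl_rel_sym compl_rel_irr.
End Complement.

Section FriendsStrangers.
Variables (n : nat) (X Y : sgraph 'I_n).

Definition FS_rel : rel {perm 'I_n} := fun s t =>
  [exists a, exists b,
    [&& edge X a b, edge Y (s a) (s b), s a == t b, s b == t a
      & [forall c, (c != a) && (c != b) ==> (s c == t c)]]].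

Lemma FS_rel_sym : symmetric FS_rel.
Proof.
suff sub s t : FS_rel s t -> FS_rel t s by move=> s t; apply/idP/idP; apply: sub.
case/existsP=> a /existsP[b /and5P[Xab Yab /eqP ab /eqP ba /forallP fix_c]].
apply/existsP; exists a; apply/existsP; exists b.
rewrite Xab -ab -ba edge_sym Yab !eqxx /=; apply/forallP=> c.
by rewrite [t c == _]eq_sym; apply: fix_c.
Qed.

Lemma FS_rel_irr : irreflexive FS_rel.
Proof.
move=> s; apply/negbTE/negP; case/existsP=> a /existsP[b].
by case/and5P=> Xab _ /eqP/perm_inj ab _ _; rewrite ab edge_irr in Xab.
Qed.

Definition FS : sgraph {perm 'I_n} := SGraph FS_rel_sym FS_rel_irr.
End FriendsStrangers.

Section Spider.
Variable lam : seq nat.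

(* None is the center; Some (Tagged _ j), with tag i, is the j-th vertex of
   the i-th leg, counted from 0 at the end joined to the center. *)
Definition spider_vertex : finType :=
  option {i : 'I_(size lam) & 'I_(nth 0 lam i)}.

Definition spider_rel : rel spider_vertex := fun u v =>
  match u, v with
  | None, None => false
  | None, Some q => tagged q == 0 :> nat
  | Some p, None => tagged p == 0 :> nat
  | Some p, Some q =>
      (tag p == tag q) &&
      (((tagged p).+1 == tagged q :> nat) || ((tagged q).+1 == tagged p :> nat))
  end.

Lemma spider_rel_sym : symmetric spider_rel.
Proof. by case=> [p|] [q|] //=; rewrite eq_sym orbC. Qed.

Lemma spider_rel_irr : irreflexive spider_rel.
Proof. by case=> [p|] //=; rewrite gtn_eqF // andbF. Qed.

Definition spider : sgraph spider_vertex := SGraph spider_rel_sym spider_rel_irr.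
End Spider.

Definition spider_with_legs (T : finType) (G : sgraph T) (m : nat) : Prop :=
  exists lam : seq nat,
    [/\ size lam = m, all (leq 1) lam, sorted geq lam & graph_iso G (spider lam)].

(* Main.v *)
Require Import Defs.
From mathcomp Require Import all_boot fingroup perm zify.

Set Implicit Arguments.
Unset Strict Implicit.
Unset Printing Implicit Defensive.

(** Vertices of [X] are positions, vertices of [Y] are people, and two people
are foes when they are adjacent in the complement of [Y].  Call a set [A] of
positions mixing for a set [B] of people if, whenever [B] occupies [A], all the
rearrangements of [B] on [A] can be reached from one another while everybody
outside [A] ends where he started.  The theorem says that the set of all
positions is mixing.

Mixing propagates from [A] to [A] plus an adjacent position [a]
([mixing_add]).  Once the person at [a] is fixed, the others mix on [A], so only
the choice of the person at [a] matters; and any friend of that person can be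
brought next to [a] and swapped in.  Hence it suffices that the friendship
graph is connected, which holds as foes are few.  By [mixing_grows] it remains
to treat [A], the copy of Spider(2,2,1,...,1) in [X], with [k + 4] positions.

Deleting the center [c] of the spider of foes leaves foes that lie along a path.
For such foes a claw with four leaves is already mixing (120 arrangements), and
so is every connected set of positions that contains such a claw
([path_mixing]).  So when [c] stands still and the positions around it stay
connected and keep such a claw, everybody else can be arranged at will, and then
[c] can walk along a path of friends.

For [k >= 4] this is enough ([hub_spider_mixing]).  Fix a leaf [y] next to the
center of [A].  From any other leaf, and from the middle vertex of a leg of
length 2, [c] can be walked to [y], since [c] has at least three friends among
the [k + 4] people.  From the center of [A], [c] can step onto a neighbor,
because the center has [k + 1] neighbors and [c] at most [k] foes.  With [c] at
[y] everybody else mixes.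

For [k = 3] the positions left are too few for this argument, and the 5040
arrangements of seven people on Spider(2,2,1,1) are searched for each of the
seven ways to share six people among at most three legs ([spider7_mixing]). *)

(** * Consecutive entries, removal of points, images under permutations *)

Definition consec (T : eqType) (s : seq T) : rel T :=
  fun u v => infix [:: u; v] s || infix [:: v; u] s.

Section Consec.
Variable T : eqType.
Implicit Types (s : seq T) (u v : T).

Lemma consecC s u v : consec s u v = consec s v u.
Proof. exact: orbC. Qed.

(** Deleting other entries keeps neighbors in a list adjacent.  It is the
reason why foes along a path or a spider remain so when people are removed. *)
Lemma consec_filter (a : pred T) s u v :
  a u -> a v -> consec s u v -> consec (filter a s) u v.
Proof.
move=> au av /orP[]/infixP[p [q ->]]; rewrite !filter_cat /= au av; apply/orP;
  [left | right]; apply/infixP; by exists (filter a p), (filter a q).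
Qed.

Lemma consec_flatten ss s u v : s \in ss -> consec s u v -> consec (flatten ss) u v.
Proof.
case/splitPr=> ss1 ss2; rewrite flatten_cat /=.
by case/orP=> /infixP[p [q ->]]; apply/orP; [left | right]; apply/infixP;
  exists (flatten ss1 ++ p), (q ++ flatten ss2); rewrite !catA.
Qed.

Lemma consec_map (U : eqType) (f : T -> U) s u v :
  consec s u v -> consec (map f s) (f u) (f v).
Proof.
by case/orP=> /infixP[p [q ->]]; apply/orP; [left | right]; apply/infixP;
  exists (map f p), (map f q); rewrite !map_cat.
Qed.

Lemma consec_nth x0 s i : i.+1 < size s -> consec s (nth x0 s i) (nth x0 s i.+1).
Proof.
move=> lt_i; apply/orP; left; apply/infixP; exists (take i s), (drop i.+2 s).
by rewrite -{1}(cat_take_drop i s) (drop_nth x0) 1?ltnW // (drop_nth x0).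
Qed.

Lemma consec_index s u v : uniq s -> consec s u v ->
  (v == nth u s (index u s).+1) || (v == nth u s (index u s).-1).
Proof.
move=> Us /orP[]/infixP[p [q def_s]]; move: Us; rewrite {}def_s /= cat_uniq.
  case/and3P=> _ /norP[/negPf p'u _] _; rewrite index_cat p'u /= eqxx addn0.
  by rewrite nth_cat ltnNge leqnSn /= subSnn eqxx.
case/and3P=> _ /norP[_ /norP[/negPf p'u _]] /andP[/norP[v'u _] _].
rewrite index_cat p'u /= (negPf v'u) eqxx addn1 /=.
by rewrite orbC nth_cat ltnn subnn eqxx.
Qed.

Lemma consec_head s c v : c \notin s -> consec (c :: s) c v -> v = head c s.
Proof.
move=> s'c /orP[]/infixP[[|x p] [q def_s]]; move: def_s s'c => /=.
- by case=> ->.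
- by case=> _ ->; rewrite mem_cat mem_head orbT.
- by case=> -> ->; rewrite mem_head.
by case=> _ ->; rewrite mem_cat !inE eqxx !orbT.
Qed.

End Consec.

Lemma map_index_uniq (T : eqType) (s : seq T) :
  uniq s -> map (index^~ s) s = iota 0 (size s).
Proof.
case: s => // x0 s; set s1 := x0 :: s => Us.
apply: (@eq_from_nth _ 0) => [|i]; rewrite size_map ?size_iota // => lti.
by rewrite (nth_map x0) // nth_iota // index_uniq.
Qed.

Lemma mem_perm_im (T : finType) (s : {perm T}) (A : {set T}) x :
  (x \in s @: A) = (s^-1%g x \in A).
Proof. by rewrite -{1}(permKV s x) mem_imset //; exact: perm_inj. Qed.

Lemma perm_im_setD1 (T : finType) (s : {perm T}) (A : {set T}) x :
  s @: (A :\ x) = (s @: A) :\ s x.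
Proof.
apply/setP=> y; rewrite -[y](permKV s) !inE !mem_imset ?inE; try exact: perm_inj.
by rewrite (inj_eq (@perm_inj _ s)).
Qed.

Lemma leq_cardD1 (T : finType) k (A : {set T}) x : k < #|A| -> k <= #|A :\ x|.
Proof. by rewrite (cardsD1 x A); case: (x \in A) => //; apply: ltnW. Qed.

Lemma card_setD1_eq (T : finType) (A B : {set T}) x y :
  x \in A -> y \in B -> #|A| = #|B| -> #|A :\ x| = #|B :\ y|.
Proof.
by move=> Ax By /eqP; rewrite (cardsD1 x A) (cardsD1 y B) Ax By eqn_add2l => /eqP.
Qed.

(** * Exhaustive search over the arrangements of a small puzzle *)

Section Search.

(** Sets of lists of numbers, as prefix trees: the flag tells whether the
list that leads to the node belongs to the set, and the children are indexed by
the next entry. *)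
Inductive trie := Trie of bool & seq trie.
Definition trie0 := Trie false [::].

Fixpoint trie_mem (t : trie) (s : seq nat) : bool :=
  let: Trie b ts := t in
  if s is x :: s' then trie_mem (nth trie0 ts x) s' else b.

Fixpoint trie_add (t : trie) (s : seq nat) : trie :=
  let: Trie b ts := t in
  if s is x :: s' then Trie b (set_nth trie0 ts x (trie_add (nth trie0 ts x) s'))
  else Trie true ts.

Lemma trie_mem0 s : trie_mem trie0 s = false.
Proof. by elim: s => //= x s IHs; rewrite nth_nil. Qed.

Lemma trie_mem_add t s s' :
  trie_mem (trie_add t s) s' -> s' = s \/ trie_mem t s'.
Proof.
elim: s t s' => [|x s IHs] [b ts] [|y s'] /=; try by [left | right].
rewrite nth_set_nth /=; case: eqP => [->|_]; last by right.
by case/IHs => [->|]; [left | right].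
Qed.

Definition swap_at (s : seq nat) i j :=
  set_nth 0 (set_nth 0 s i (nth 0 s j)) j (nth 0 s i).

Lemma size_swap_at s i j : i < size s -> j < size s -> size (swap_at s i j) = size s.
Proof. by move=> ltis ltjs; rewrite !size_set_nth; lia. Qed.

Lemma nth_swap_at s i j z :
  nth 0 (swap_at s i j) z =
  if z == j then nth 0 s i else if z == i then nth 0 s j else nth 0 s z.
Proof. by rewrite !nth_set_nth /= nth_set_nth /=. Qed.

Lemma swap_atK s i j :
  i < size s -> j < size s -> swap_at (swap_at s i j) i j = s.
Proof.
move=> ltis ltjs; apply: (@eq_from_nth _ 0) => [|z _]; first by rewrite !size_swap_at.
rewrite !nth_swap_at !eqxx.
by case: eqP => [->|_]; [case: eqP => [->|] | case: eqP => [->|]].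
Qed.

Variables (E : seq (nat * nat)) (foe : rel nat).

(** An arrangement [s] lists the people, numbered from 0, by position; [E]
lists the edges between positions. *)
Definition moves s :=
  [seq swap_at s e.1 e.2 | e <- E & ~~ foe (nth 0 s e.1) (nth 0 s e.2)].

Inductive reach N : seq nat -> Prop :=
| reach0 : reach N (iota 0 N)
| reachS s t of reach N s & t \in moves s : reach N t.

(** The search state is the set of visited arrangements and the frontier,
the list of those found in the current round. *)
Definition visit (vf : trie * seq (seq nat)) s :=
  if trie_mem vf.1 s then vf else (trie_add vf.1 s, s :: vf.2).

Fixpoint bfs d (vf : trie * seq (seq nat)) : trie :=
  if d is d'.+1 then
    bfs d' (foldl (fun w s => foldl visit w (moves s)) (vf.1, [::]) vf.2)
  else vf.1.

Definition reached N (vf : trie * seq (seq nat)) :=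
  (forall s, trie_mem vf.1 s -> reach N s) /\ (forall s, s \in vf.2 -> reach N s).

Lemma visit_reached N vf s : reach N s -> reached N vf -> reached N (visit vf s).
Proof.
move=> Rs [Rv Rf]; rewrite /visit; case: ifP => // _; split=> t /=.
  by case/trie_mem_add=> [->|/Rv].
by rewrite inE => /orP[/eqP->|/Rf].
Qed.

Lemma bfs_reached N d vf s : reached N vf -> trie_mem (bfs d vf) s -> reach N s.
Proof.
elim: d vf => [|d IHd] [V f] [/= RV /= Rf] /=; first exact: RV.
apply: IHd; have: reached N (V, [::]) by [].
elim: f (V, [::]) Rf => //= t f IHf w Rf Rw.
apply: IHf => [u f_u|]; first by apply: Rf; rewrite inE f_u orbT.
have Rt: reach N t by apply: Rf; rewrite mem_head.
have: forall u, u \in moves t -> reach N u by move=> u; exact: reachS.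
elim: (moves t) w Rw => //= u ms IHms w Rw Rms.
apply: IHms => [|v ms_v]; last by apply: Rms; rewrite inE ms_v orbT.
by apply: visit_reached => //; apply: Rms; rewrite mem_head.
Qed.

(** Soundness does not depend on the bound 60 on the number of rounds, which
is large enough for the two searches. *)
Definition all_reached N :=
  let V := bfs 60 (visit (trie0, [::]) (iota 0 N)) in
  all (trie_mem V) (permutations (iota 0 N)).

Lemma all_reachedP N s : all_reached N -> perm_eq s (iota 0 N) -> reach N s.
Proof.
move=> /allP allV; rewrite -mem_permutations => /allV; apply: bfs_reached.
apply: visit_reached; first exact: reach0.
by split=> // t; rewrite trie_mem0.
Qed.

End Search.

(** Person 0 is the center, and consecutive entries of a leg are foes. *)
Definition leg_foes (legs : seq (seq nat)) : rel nat :=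
  fun i j => has (fun l => consec (0 :: l) i j) legs.

(** The search looks foes up in a table, since testing adjacency in the legs
at every move would dominate its cost. *)
Definition table N (r : rel nat) := mkseq (fun i => mkseq (r i) N) N.
Definition lookup (tb : seq (seq bool)) : rel nat :=
  fun i j => nth false (nth [::] tb i) j.

Lemma lookup_table N r i j : i < N -> j < N -> lookup (table N r) i j = r i j.
Proof. by move=> ltiN ltjN; rewrite /lookup !nth_mkseq. Qed.

(** [sh] lists the lengths of the legs, along which the people 1, 2, ... are
numbered consecutively. *)
Definition search E sh N :=
  let tb := table N (leg_foes (reshape sh (iota 1 N.-1))) in
  all_reached E (lookup tb) N.

Definition claw4 := [:: (0, 1); (0, 2); (0, 3); (0, 4)].
Definition spider2211 := [:: (0, 1); (1, 2); (0, 3); (3, 4); (0, 5); (0, 6)].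

Lemma search_claw4 : search claw4 [:: 4] 5.
Proof. by vm_compute. Qed.

(** Partitions of 6 into at most three parts, padded with empty legs. *)
Definition shapes6 := [:: [:: 6; 0; 0]; [:: 5; 1; 0]; [:: 4; 2; 0]; [:: 3; 3; 0];
                          [:: 4; 1; 1]; [:: 3; 2; 1]; [:: 2; 2; 2]].

Lemma search_spider2211 : all (fun sh => search spider2211 sh 7) shapes6.
Proof. by vm_compute. Qed.

Lemma sorted_shapes6 sh : size sh = 3 -> sorted geq sh -> sumn sh = 6 -> sh \in shapes6.
Proof.
case: sh => [|a [|b [|c [|? ?]]]] //= _ /and3P[leba lecb _] sum6.
have -> : a = 6 - b - c by lia.
have: b <= 3 by lia.
have: c <= 2 by lia.
by move: leba lecb sum6; case: c => [|[|[|c]]] //; case: b => [|[|[|[|b]]]] //; lia.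
Qed.

Lemma reach_size E foe N t :
  {in E, forall e, e.1 < N /\ e.2 < N} -> reach E foe N t -> size t = N.
Proof.
move=> ltE; elim=> [|s t' _ sz /mapP[e]]; first by rewrite size_iota.
by rewrite mem_filter => /andP[_ /ltE[lt1 lt2]] ->; rewrite size_swap_at ?sz.
Qed.

(** * Mixing: rearranging the people on a set of positions *)

Section Mixing.
Local Open Scope group_scope.
Variables (n : nat) (X Y : sgraph 'I_n).
Implicit Types (s t : {perm 'I_n}) (A B : {set 'I_n}) (x y : 'I_n).
Local Notation foe := (compl_rel Y).

Definition agree_off A s t := forall x, x \notin A -> s x = t x.

(** Everyone outside [A] may move on the way from [s] to [t], provided that he
is back at the end. *)
Definition shuffle A s t := connect (FS_rel X Y) s t /\ agree_off A s t.

Definition mixing A B :=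
  forall s t, s @: A = B -> agree_off A s t -> connect (FS_rel X Y) s t.

Lemma FS_connect_sym : connect_sym (FS_rel X Y).
Proof. exact/sym_connect_sym/FS_rel_sym. Qed.

Lemma agree_offC A s t : agree_off A s t -> agree_off A t s.
Proof. by move=> st x /st. Qed.

Lemma agree_off_trans A t s u :
  agree_off A s t -> agree_off A t u -> agree_off A s u.
Proof. by move=> st tu x Ax; rewrite st ?tu. Qed.

Lemma agree_offS A A' s t : A \subset A' -> agree_off A s t -> agree_off A' s t.
Proof. by move=> sAA' st x A'x; apply: st; apply: contra A'x; apply: (subsetP sAA'). Qed.

Lemma agree_off_im A s t : agree_off A s t -> s @: A = t @: A.
Proof.
suff sub s' t' : agree_off A s' t' -> t' @: A \subset s' @: A.
  by move=> st; apply/eqP; rewrite eqEsubset !sub //; exact: agree_offC.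
move=> st; apply/subsetP=> z; rewrite !mem_perm_im; apply: contraLR => Az.
by rewrite -[z in t'^-1 z](permKV s') st // permK.
Qed.

Lemma shuffle_refl A s : shuffle A s s.
Proof. by split. Qed.

Lemma shuffle_trans A t s u : shuffle A s t -> shuffle A t u -> shuffle A s u.
Proof.
move=> [st ag_st] [tu ag_tu]; split; first exact: connect_trans st tu.
exact: agree_off_trans ag_st ag_tu.
Qed.

Lemma shuffleS A A' s t : A \subset A' -> shuffle A s t -> shuffle A' s t.
Proof. by move=> sAA' [st ag]; split=> //; exact: agree_offS ag. Qed.

Lemma mixing_shuffle A B s t :
  mixing A B -> s @: A = B -> agree_off A s t -> shuffle A s t.
Proof. by move=> mAB sA st; split=> //; exact: mAB. Qed.

Lemma swapE s x y z :
  (tperm x y * s) z = if z == x then s y else if z == y then s x else s z.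
Proof.
rewrite permM; case: tpermP => [->|->|/eqP/negPf-> /eqP/negPf->] //.
  by rewrite eqxx.
by rewrite eqxx; case: eqP => [->|].
Qed.

Lemma agree_off_swap A s x y :
  x \in A -> y \in A -> agree_off A s (tperm x y * s).
Proof.
move=> Ax Ay z Az; rewrite swapE.
by rewrite !ifN //; apply: contraNneq Az => ->.
Qed.

Lemma shuffle_swap A s x y :
  x \in A -> y \in A -> edge X x y -> edge Y (s x) (s y) ->
  shuffle A s (tperm x y * s).
Proof.
move=> Ax Ay Xxy Ysxy; split; last exact: agree_off_swap.
apply/connect1/existsP; exists x; apply/existsP; exists y.
rewrite Xxy Ysxy !swapE !eqxx.
have /negPf-> : y != x by apply: contraTneq Xxy => ->; rewrite edge_irr.
rewrite !eqxx; apply/forallP=> z; apply/implyP=> /andP[zx zy].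
by rewrite swapE (negPf zx) (negPf zy).
Qed.

(** Prepares the walks below: as many members of [F] as needed are put on the
positions [bs] by permuting the people of [A].  Legal moves that realize the permutation
come from mixing. *)
Lemma placement A (F : {set 'I_n}) bs s :
    uniq bs -> {subset bs <= A} -> size bs <= #|F :&: s @: A| ->
  exists t, agree_off A s t /\ {in bs, forall b, t b \in F}.
Proof.
elim: bs A F s => [|b bs IHbs] A F s /=; first by move=> *; exists s.
move=> /andP[b'bs Ubs] sbA ltF.
have Ab: b \in A by apply: sbA; rewrite mem_head.
have /card_gt0P[f]: 0 < #|F :&: s @: A| by apply: leq_ltn_trans ltF.
rewrite inE => /andP[Ff /imsetP[z Az def_f]].
set s1 := tperm b z * s.
have ag1: agree_off A s s1 by exact: agree_off_swap.
have s1b: s1 b = f by rewrite swapE eqxx.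
have [||t [ag_t tF]] := IHbs (A :\ b) (F :\ f) s1 Ubs.
- move=> x bs_x; rewrite !inE sbA ?inE ?bs_x ?orbT // andbT.
  by apply: contraNneq b'bs => <-.
- suff ->: (F :\ f) :&: s1 @: (A :\ b) = (F :&: s @: A) :\ f.
    by rewrite -ltnS (leq_trans ltF) // (cardsD1 f (F :&: _)) inE Ff def_f imset_f.
  apply/setP=> x; rewrite !inE mem_perm_im !inE -mem_perm_im -(agree_off_im ag1).
  rewrite -[_ x == b](inj_eq (@perm_inj _ s1)) permKV s1b.
  by case: (x == f); rewrite /= ?andbF.
exists t; split.
  by apply: agree_off_trans ag1 _; apply: agree_offS ag_t; exact: subD1set.
move=> x; rewrite inE => /predU1P[->|/tF]; last by rewrite inE => /andP[].
by rewrite -ag_t ?s1b // !inE eqxx.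
Qed.

(** Successive swaps carry the person at [a] along [bs], because everybody met
on the way is a friend. *)
Lemma walk A a bs s :
    path (edge X) a bs -> uniq (a :: bs) -> {subset a :: bs <= A} ->
    {in bs, forall b, edge Y (s a) (s b)} ->
  exists2 t, shuffle A s t & t (last a bs) = s a.
Proof.
elim: bs a s => [|b bs IHbs] a s /=; first by exists s => //; exact: shuffle_refl.
move=> /andP[Xab Xbs] /and3P[a'bs b'bs Ubs] sA frs.
have Aa: a \in A by apply: sA; rewrite mem_head.
have Ab: b \in A by apply: sA; rewrite !inE eqxx orbT.
set s1 := tperm a b * s.
have s1b: s1 b = s a by rewrite swapE eqxx; case: eqP => [->|].
have [|||t sh_t tE] := IHbs b s1 Xbs.
- by rewrite /= b'bs.
- by move=> x bs_x; apply: sA; rewrite inE bs_x orbT.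
- move=> x bs_x; rewrite s1b swapE.
  have /negPf->: x != a by apply: contraNneq a'bs => <-; rewrite inE bs_x orbT.
  have /negPf->: x != b by apply: contraNneq b'bs => <-.
  by apply: frs; rewrite inE bs_x orbT.
exists t; last by rewrite tE.
apply: shuffle_trans sh_t; apply: shuffle_swap => //.
by apply: frs; rewrite mem_head.
Qed.

Definition friends_connected B :=
  {in B &, forall p q, connect [rel u v | edge Y u v && (v \in B)] p q}.

(** The people who can be brought to [a] form a union of components of the
friendship graph on [B]: with [p] at [a], a friend of [p] can be placed at [x]
using that [A] is mixing for the others, and the two then swap. *)
Lemma mixing_add A B a x :
    x \in A -> a \notin A -> edge X x a -> friends_connected B ->
  {in B, forall p, mixing A (B :\ p)} -> mixing (a |: A) B.
Proof.
move=> Ax A'a Xxa fcB mixA s t sB st.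
have A1a: a \in a |: A by rewrite !inE eqxx.
have im1 (u : {perm 'I_n}) : u @: (a |: A) = B -> (u a \in B) * (u @: A = B :\ u a).
  move=> uB; split; first by rewrite -uB imset_f.
  rewrite -uB imsetU1 setU1K //; apply/imsetP=> [[z Az az]].
  by rewrite (perm_inj az) Az in A'a.
have tB: t @: (a |: A) = B by rewrite -sB (agree_off_im st).
have [s' sh_s' s'a]: exists2 s', shuffle (a |: A) s s' & s' a = t a.
  have /connectP[ps] := fcB _ _ (im1 _ sB).1 (im1 _ tB).1.
  elim: ps s sB {st} => [|p ps IHps] s sB /=; first by exists s => //; exact: shuffle_refl.
  case/andP=> /andP[Yp Bp] fr_ps def_ta.
  (* The next person p on the friendship path comes to x, then enters a. *)
  have [||t1 [ag1 t1x]] := @placement A [set p] [:: x] s isT.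
  - by move=> y; rewrite inE => /eqP->.
  - rewrite (im1 _ sB).2 (_ : _ :&: _ = [set p]) ?cards1 //; apply/setP=> y.
    rewrite !inE andb_idr // => /eqP->; rewrite Bp andbT.
    by apply: contraTneq Yp => ->; rewrite edge_irr.
  have {t1x} t1x: t1 x = p by apply/set1P/t1x; rewrite mem_head.
  have sh1: shuffle (a |: A) s t1.
    apply: (@shuffleS A); first exact: subsetU1.
    by apply: mixing_shuffle ag1; rewrite ?(im1 _ sB).2 //; apply/mixA/(im1 _ sB).1.
  have t1a: t1 a = s a by rewrite -ag1.
  have sh2: shuffle (a |: A) t1 (tperm x a * t1).
    by apply: shuffle_swap; rewrite // ?inE ?Ax ?orbT // t1x t1a edge_sym.
  have sh12 := shuffle_trans sh1 sh2.
  have t2a: (tperm x a * t1) a = p by rewrite swapE eqxx; case: eqP => [->|].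
  have [|||s' sh_s' s'a] := IHps (tperm x a * t1).
  - by rewrite -sB (agree_off_im sh12.2).
  - by rewrite t2a.
  - by rewrite t2a.
  by exists s' => //; exact: shuffle_trans sh12 sh_s'.
apply: connect_trans sh_s'.1 _.
have s'B: s' @: (a |: A) = B by rewrite -sB (agree_off_im sh_s'.2).
apply: (mixA (s' a) (im1 _ s'B).1); first exact: (im1 _ s'B).2.
move=> y A'y; have [->|y'a] := eqVneq y a; first by [].
by rewrite -sh_s'.2 ?st // !inE negb_or y'a.
Qed.

Inductive grows A : {set 'I_n} -> Prop :=
| grows0 : grows A A
| growsS A' x a of grows A A' & x \in A' & a \notin A' & edge X x a :
    grows A (a |: A').

(** Iterates [mixing_add] for a hereditary property [Q] of sets of people. *)
Lemma mixing_grows (Q : {set 'I_n} -> Prop) A A' :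
    (forall B p, Q B -> p \in B -> Q (B :\ p)) ->
    (forall B, Q B -> #|A| < #|B| -> friends_connected B) ->
    (forall B, Q B -> #|B| = #|A| -> mixing A B) ->
    grows A A' -> forall B, Q B -> #|B| = #|A'| -> mixing A' B.
Proof.
move=> QD Qfc mixA grA.
suff [//]: #|A| <= #|A'| /\ forall B, Q B -> #|B| = #|A'| -> mixing A' B.
elim: {A'}grA => [|A' x a _ [leA IHA'] A'x A'a Xxa]; first by [].
split=> [|B QB cardB]; first by apply: leq_trans leA _; rewrite cardsU1 leq_addl.
rewrite cardsU1 A'a in cardB.
apply: (@mixing_add _ _ _ x) => //; first by apply: Qfc => //; rewrite cardB ltnS.
move=> p Bp; apply: IHA'; first exact: QD.
by move/eqP: cardB; rewrite (cardsD1 p B) Bp eqn_add2l => /eqP.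
Qed.

(** A path from [x] to a position not yet attached leaves the attached set
along an edge inside [A']. *)
Lemma grows_connected A A' x :
    x \in A -> A \subset A' ->
    {in A', forall a, connect [rel u v | edge X u v && (v \in A')] x a} ->
  grows A A'.
Proof.
move=> Ax sAA' conA'.
suff gr d A1 : #|A' :\: A1| = d -> grows A A1 -> A \subset A1 -> A1 \subset A' ->
    grows A A'.
  exact: (@gr _ A erefl (grows0 A)).
elim: d A1 => [|d IHd] A1 cardD gr sAA1 sA1A'.
  suff <-: A1 = A' by [].
  apply/eqP; rewrite eqEsubset sA1A' -setD_eq0 -cards_eq0; exact/eqP.
have /card_gt0P[z]: 0 < #|A' :\: A1| by rewrite cardD.
rewrite inE => /andP[A1'z A'z].
have [u [v [A1u A1'v A'v Xuv]]]:
    exists u v, [/\ u \in A1, v \notin A1, v \in A' & edge X u v].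
  have /connectP[p] := conA' z A'z.
  have: x \in A1 by exact: (subsetP sAA1).
  elim: p x {Ax conA'} => [|b p IHp] x A1x /=; first by move=> _ zx; rewrite zx A1x in A1'z.
  case/andP=> /andP[Xxb A'b] Xp def_z.
  by case A1b: (b \in A1); [exact: IHp A1b Xp def_z | exists x, b; rewrite A1b].
apply: (IHd (v |: A1)).
- apply/eqP; rewrite -eqSS -cardD (cardsD1 v (A' :\: A1)) inE A1'v A'v add1n eqSS.
  by apply/eqP; congr #|pred_of_set _|; apply/setP=> w; rewrite !inE negb_or andbA.
- exact: growsS Xuv.
- by rewrite (subset_trans sAA1) // subsetU1.
by rewrite subUset sub1set A'v.
Qed.

(** ** From searches to positions and people *)

(** Transfers a search to the graphs.  An occupation of [P] by [L] is coded by
the list of the indices in [L] of the people found along [P]; legal moves of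
codes lift to swaps along edges of [X], so both given arrangements can be
brought to the one with code 0, 1, 2, ..., where they coincide.  The hypothesis
on foes is an implication only: fewer foes than in the search do no harm. *)
Lemma search_mixing E sh N (P L : seq 'I_n) x0 :
    search E sh N ->
    size P = N -> uniq P -> size L = N -> uniq L ->
    {in E, forall e, [&& e.1 < N, e.2 < N & edge X (nth x0 P e.1) (nth x0 P e.2)]} ->
    {in L &, forall u v, foe u v ->
      leg_foes (reshape sh (iota 1 N.-1)) (index u L) (index v L)} ->
  mixing [set x in P] [set u in L].
Proof.
move=> srch szP UP szL UL EP foeL.
set A := [set x in P].
pose r := lookup (table N (leg_foes (reshape sh (iota 1 N.-1)))).
have {}srch: all_reached E r N := srch.
have ltE: {in E, forall e, e.1 < N /\ e.2 < N}.
  by move=> e /EP/and3P[].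
pose code s := [seq index (s x) L | x <- P].
have inL s x : s @: A = [set u in L] -> x \in P -> s x \in L.
  by move=> sA Px; rewrite -[_ \in L]inE -sA imset_f ?inE.
have szc s : size (code s) = N by rewrite size_map.
have nth_code s i : i < N -> nth 0 (code s) i = index (s (nth x0 P i)) L.
  by move=> ltiN; rewrite (nth_map x0) ?szP.
have code_perm s : s @: A = [set u in L] -> perm_eq (code s) (iota 0 N).
  move=> sA.
  have Uc: uniq (code s).
    rewrite map_inj_in_uniq // => x y Px Py eq_i.
    apply: (@perm_inj _ s); rewrite -(nth_index x0 (inL s x sA Px)) eq_i.
    by rewrite nth_index // inL.
  have [||_ eq_c] := uniq_min_size Uc (_ : {subset _ <= iota 0 N}).
  - move=> _ /mapP[x Px ->]; rewrite mem_iota /= add0n -szL index_mem.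
    exact: inL.
  - by rewrite size_iota szc.
  by apply: uniq_perm; rewrite ?iota_uniq.
(* A swap is its own inverse, so the discovery of a code is traced back. *)
have back c : reach E r N c -> forall s, s @: A = [set u in L] -> code s = c ->
    exists2 s0, shuffle A s s0 & code s0 = iota 0 N.
  elim=> [|t t1 Rt IHt /mapP[[i j]]] /=.
    by move=> s _ cs; exists s => //; exact: shuffle_refl.
  rewrite mem_filter /= => /andP[fr_ij Eij] -> s sA cs.
  have /and3P[/= ltiN ltjN Xij] := EP _ Eij.
  have szt: size t = N by apply: reach_size Rt.
  set x := nth x0 P i in Xij; set y := nth x0 P j in Xij.
  have Px: x \in P by rewrite mem_nth ?szP.
  have Py: y \in P by rewrite mem_nth ?szP.
  have neq_yx: y != x by apply: contraTneq Xij => ->; rewrite edge_irr.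
  have ti: nth 0 t i = index (s y) L.
    by rewrite -nth_code // cs nth_swap_at eqxx.
  have tj: nth 0 t j = index (s x) L.
    rewrite -nth_code // cs nth_swap_at eqxx; case: eqP => // eq_ij.
    by rewrite /x /y eq_ij eqxx in neq_yx.
  have fr_xy: edge Y (s x) (s y).
    rewrite edge_sym; apply: contraNT fr_ij => en.
    have ltxN z: z \in P -> index (s z) L < N by move=> Pz; rewrite -szL index_mem inL.
    rewrite /r ti tj lookup_table ?ltxN //.
    by apply: foeL; rewrite ?inL // /compl_rel en (inj_eq perm_inj) neq_yx.
  have sh1: shuffle A s (tperm x y * s) by apply: shuffle_swap; rewrite ?inE.
  have [||s0 sh0 c0] := IHt (tperm x y * s).
  - by rewrite -sA (agree_off_im sh1.2).
  - rewrite -(@swap_atK t i j) ?szt // -cs.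
    apply: (@eq_from_nth _ 0) => [|z]; rewrite ?size_swap_at ?szc // => ltzN.
    rewrite nth_swap_at !nth_code // swapE.
    rewrite -/x -/y /x /y !nth_uniq ?szP //.
    by case: (z =P i) => [->|_]; case: (_ =P j) => // ->.
  by exists s0 => //; exact: shuffle_trans sh1 sh0.
move=> s t sA st.
have tA: t @: A = [set u in L] by rewrite -sA (agree_off_im st).
have [s0 sh_s0 cs0] := back _ (all_reachedP srch (code_perm s sA)) s sA erefl.
have [t0 sh_t0 ct0] := back _ (all_reachedP srch (code_perm t tA)) t tA erefl.
suff eq_st: s0 = t0.
  by apply: connect_trans sh_s0.1 _; rewrite eq_st FS_connect_sym sh_t0.1.
have s0A: s0 @: A = [set u in L] by rewrite -sA (agree_off_im sh_s0.2).
have t0A: t0 @: A = [set u in L] by rewrite -tA (agree_off_im sh_t0.2).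
apply/permP=> x; have [Px|P'x] := boolP (x \in P); last first.
  by rewrite -sh_s0.2 ?st -?sh_t0.2 ?inE.
have /(congr1 (nth 0 ^~ (index x P))) : code s0 = code t0 by rewrite cs0.
rewrite !nth_code -?szP ?index_mem // nth_index // => eq_i.
rewrite -(nth_index x0 (inL s0 x s0A Px)) eq_i.
by rewrite nth_index // inL.
Qed.

(** ** Foes along a path or along a spider *)

(** The foes form a subgraph of a path rather than a path: this is what makes
the property hereditary, a removed person being bridged over. *)
Definition path_foes B := exists p,
  [/\ uniq p, B =i p & {in B &, forall u v, foe u v -> consec p u v}].

(** As for paths, the foes only form a subgraph of the spider, and legs may be
empty. *)
Definition spider_foes c legs B :=
  [/\ uniq (c :: flatten legs), B =i c :: flatten legs
    & {in B &, forall u v, foe u v -> has (fun l => consec (c :: l) u v) legs}].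

Lemma path_foesD1 B z : path_foes B -> path_foes (B :\ z).
Proof.
case=> p [Up Bp foeB]; exists (filter (predC1 z) p).
split=> [|u|u v]; rewrite ?filter_uniq // ?mem_filter ?inE ?Bp //.
move=> /andP[zu pu] /andP[zv pv] foe_uv; apply: consec_filter => //.
by apply: foeB; rewrite ?Bp.
Qed.

(** The legs, put end to end, form a single path. *)
Lemma spider_foes_remove_center c legs B : spider_foes c legs B -> path_foes (B :\ c).
Proof.
case=> /andP[c'legs Ulegs] Bp foeB; exists (flatten legs).
split=> // [u|u v]; rewrite !inE !Bp !inE.
  by have [->|] := eqVneq u c; first by rewrite (negPf c'legs).
move=> /andP[cu Bu] /andP[cv Bv] foe_uv.
have /hasP[l legs_l] := foeB u v (etrans (Bp u) Bu) (etrans (Bp v) Bv) foe_uv.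
move/(consec_filter (a := predC1 c) cu cv)=> /=; rewrite eqxx /=.
rewrite (_ : filter _ l = l); first exact: consec_flatten.
apply/all_filterP/allP=> w l_w /=; apply: contraNneq c'legs => <-.
by apply/flattenP; exists l.
Qed.

Lemma spider_foesD1 c legs B z : z != c ->
  spider_foes c legs B -> spider_foes c (map (filter (predC1 z)) legs) (B :\ z).
Proof.
move=> zc [/andP[c'legs Ulegs] Bp foeB]; have cz: c != z by rewrite eq_sym.
rewrite /spider_foes -filter_flatten; split=> [|u|u v].
- by rewrite /= mem_filter negb_and c'legs orbT filter_uniq.
- by rewrite !inE Bp !inE mem_filter /=; case: eqP => [->|] //=; rewrite (negPf zc).
rewrite !inE => /andP[zu Bu] /andP[zv Bv] foe_uv; rewrite has_map.
apply: sub_has (foeB u v Bu Bv foe_uv) => l /=.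
by move/(consec_filter (a := predC1 z) zu zv)=> /=; rewrite cz.
Qed.

(** Two foes [u] and [v] have together at most four foes, counting [u] and [v]
themselves, so a fifth person is a friend of both. *)
Lemma path_friends_connected B : path_foes B -> 5 <= #|B| -> friends_connected B.
Proof.
case=> p [Up Bp foeB] leB u v Bu Bv.
have [<-|neq_uv] := eqVneq u v; first exact: connect0.
have [Yuv|Y'uv] := boolP (edge Y u v); first by apply: connect1; rewrite /= Yuv.
(* When w is at an end of p, one of these two is w itself by default. *)
pose N w := [set nth w p (index w p).+1; nth w p (index w p).-1].
have foeN w z : w \in B -> z \in B -> foe w z -> z \in N w.
  by move=> Bw Bz wz; rewrite !inE consec_index // foeB.
have: 0 < #|B :\: (N u :|: N v)|.
  rewrite -subn_gt0 in leB *; have: #|N u :|: N v| <= 4.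
    by rewrite (leq_trans (leq_card_setU _ _)) // (@leq_add _ _ 2 2) // cards2; case: eqP.
  have := cardsID (N u :|: N v) B; have := subset_leq_card (subsetIr B (N u :|: N v)).
  lia.
case/card_gt0P=> w; rewrite in_setD in_setU negb_or => /andP[/andP[N'uw N'vw] Bw].
have foe_uv : foe u v by rewrite /compl_rel neq_uv.
have friendly z : z \in B -> z != w -> w \notin N z -> edge Y z w.
  by move=> Bz zw; apply: contraNT => Y'zw; apply: foeN; rewrite // /compl_rel zw.
have Nuv: v \in N u by exact: foeN.
have Nvu: u \in N v by apply: foeN; rewrite // compl_rel_sym.
have Yuw: edge Y u w by apply: friendly => //; apply: contraNneq N'vw => <-.
have Ywv: edge Y w v.
  by rewrite edge_sym; apply: friendly => //; apply: contraNneq N'uw => <-.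
by apply: (connect_trans (y := w)); apply: connect1; rewrite /= ?Yuw ?Ywv.
Qed.

(** A foe of the center is the first vertex of a leg. *)
Lemma center_foes_card c legs B : spider_foes c legs B ->
  #|[set v in B | foe c v]| <= size legs.
Proof.
case=> /andP[c'legs Ulegs] Bp foeB.
rewrite -(size_map (head c)) (leq_trans _ (card_size _)) //.
apply/subset_leq_card/subsetP=> v; rewrite inE => /andP[Bv foe_cv].
have /hasP[l legs_l] : has (fun l => consec (c :: l) c v) legs.
  by apply: foeB => //; rewrite Bp mem_head.
move/consec_head=> ->; first exact: map_f.
by apply: contra c'legs => l_c; apply/flattenP; exists l.
Qed.

Lemma center_friends_card c legs B :
  spider_foes c legs B -> #|B| <= (size legs).+1 + #|[set v in B | edge Y c v]|.
Proof.
move=> spB; have Bc: c \in B by case: spB => _ -> _; rewrite mem_head.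
have := center_foes_card spB.
set F := [set v in B | foe c v]; set G := [set v in B | edge Y c v].
have sub: B \subset [set c] :|: F :|: G.
  apply/subsetP=> v Bv; rewrite !inE Bv /compl_rel /= eq_sym.
  by case: eqP; case: (edge Y c v).
have := subset_leq_card sub; have [+ _] := leq_card_setU ([set c] :|: F) G.
by have [+ _] := leq_card_setU [set c] F; rewrite cards1; lia.
Qed.

(** The center has a friend, by counting, and the others are connected among
themselves by [path_friends_connected]. *)
Lemma spider_friends_connected c legs B :
  spider_foes c legs B -> 6 <= #|B| -> (size legs).+1 < #|B| -> friends_connected B.
Proof.
move=> spB le6 ltB; have Bc: c \in B by case: spB => _ -> _; rewrite mem_head.
have: 0 < #|[set v in B | edge Y c v]|.
  by have := center_friends_card spB; lia.
case/card_gt0P=> o; rewrite inE => /andP[Bo Yco].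
have oc: o != c by apply: contraTneq Yco => ->; rewrite edge_irr.
have fcD: friends_connected (B :\ c).
  apply: path_friends_connected; first exact: spider_foes_remove_center spB.
  by rewrite (cardsD1 c) Bc in le6.
have lift u v : u \in B -> v \in B -> u != c -> v != c ->
  connect [rel u v | edge Y u v && (v \in B)] u v.
  move=> Bu Bv uc vc; apply: connect_sub (fcD u v _ _); rewrite ?inE ?uc ?vc //.
  by move=> w z /=; rewrite !inE => /and3P[Ywz _ Bz]; apply: connect1; rewrite /= Ywz.
have toc u : u \in B -> connect [rel u v | edge Y u v && (v \in B)] u c.
  move=> Bu; have [->|uc] := eqVneq u c; first exact: connect0.
  apply: connect_trans (lift u o Bu Bo uc oc) _.
  by apply: connect1; rewrite /= edge_sym Yco.
move=> u v Bu Bv; apply: connect_trans (toc u Bu) _.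
have [->|vc] := eqVneq v c; first exact: connect0.
by apply: connect_trans (lift o v Bo Bv oc vc); apply: connect1; rewrite /= Yco.
Qed.

(** ** Mixing when the foes lie along a path *)

(** By search, with the first person of the path as the center of a spider with
one leg. *)
Lemma claw_path_mixing x0 zs B :
    size zs = 4 -> uniq (x0 :: zs) -> {in zs, forall z, edge X x0 z} ->
  path_foes B -> #|B| = 5 -> mixing [set x in x0 :: zs] B.
Proof.
move=> szz Uz Xz [p [Up Bp foeB]] cardB.
have szp: size p = 5 by rewrite -(card_uniqP Up) -cardB; apply: eq_card => x; rewrite -Bp.
rewrite (_ : B = [set u in p]); last by apply/setP=> x; rewrite inE.
apply: (search_mixing (x0 := x0) search_claw4) => //.
- by rewrite /= szz.
- move=> e; rewrite !inE => eE.
  by case/or4P: eE => /eqP->; rewrite /= Xz // mem_nth ?szz.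
move=> u v; rewrite -!Bp => Bu Bv /(foeB u v Bu Bv)/(consec_map (index^~ p)).
by rewrite map_index_uniq // szp /leg_foes /= orbF.
Qed.

(** The claw with center [x0] and four leaves is the seed from which [A]
grows. *)
Lemma path_mixing x0 A :
    x0 \in A -> 4 <= #|[set z in A | edge X x0 z]| ->
    {in A, forall a, connect [rel u v | edge X u v && (v \in A)] x0 a} ->
  forall B, path_foes B -> #|B| = #|A| -> mixing A B.
Proof.
move=> Ax0 le4 conA.
set Z := [set z in A | _] in le4; pose zs := take 4 (enum Z).
have szz: size zs = 4 by rewrite size_takel // -cardE.
have zsP z : z \in zs -> z \in A /\ edge X x0 z.
  by move/mem_take; rewrite mem_enum inE => /andP[].
have Uz: uniq (x0 :: zs).
  rewrite /= take_uniq ?enum_uniq // andbT.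
  by apply/negP=> /zsP[_]; rewrite edge_irr.
have cardA0: #|[set x in x0 :: zs]| = 5 by rewrite cardsE (card_uniqP Uz) /= szz.
apply: (@mixing_grows path_foes [set x in x0 :: zs]).
- by move=> B p pathB _; exact: path_foesD1.
- move=> B pathB; rewrite cardA0 => ltB.
  by apply: path_friends_connected => //; exact: ltnW.
- by move=> B pathB cardB; apply: claw_path_mixing; rewrite // -?cardA0 // => z /zsP[].
apply: (grows_connected (x := x0)) => //; first by rewrite inE mem_head.
by apply/subsetP=> z; rewrite inE => /predU1P[->//|/zsP[]].
Qed.

(** ** Mixing when the foes lie along a spider *)

(** The copy of the spider in [X]: center [x0], set [M] of its neighbors, and
two legs of length 2 that end in [l] and [l']. *)
Section Hub.
Variables (x0 m l m' l' : 'I_n) (M : {set 'I_n}).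
Hypotheses (Mx0 : x0 \notin M) (M_m : m \in M) (M_m' : m' \in M) (mm' : m != m').
Hypotheses (Ml : l \notin x0 |: M) (Ml' : l' \notin x0 |: M) (ll' : l != l').
Hypothesis (XM : {in M, forall z, edge X x0 z}).
Hypotheses (Xml : edge X m l) (Xml' : edge X m' l').
Let A := [set l; l'] :|: (x0 |: M).

(** A part of the spider that contains the center and, with each tip, the
vertex below it is connected. *)
Lemma hub_path_mixing A' B :
    A' \subset A -> x0 \in A' -> (l \in A' -> m \in A') -> (l' \in A' -> m' \in A') ->
    4 <= #|M :&: A'| -> path_foes B -> #|B| = #|A'| ->
  mixing A' B.
Proof.
move=> sA'A A'x0 A'l A'l' le4; apply: (path_mixing (x0 := x0)) => //.
  apply: leq_trans le4 _; apply/subset_leq_card/subsetP=> z; rewrite !inE.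
  by case/andP=> /XM-> ->.
have toM z : z \in M -> z \in A' -> connect [rel u v | edge X u v && (v \in A')] x0 z.
  by move=> Mz A'z; apply: connect1; rewrite /= XM.
move=> a A'a; move/(subsetP sA'A): (A'a); rewrite !inE -orbA.
case/or4P=> [/eqP al|/eqP al|/eqP->|Ma].
- rewrite al in A'a *; apply: connect_trans (toM m M_m (A'l A'a)) _.
  by apply: connect1; rewrite /= Xml.
- rewrite al in A'a *; apply: connect_trans (toM m' M_m' (A'l' A'a)) _.
  by apply: connect1; rewrite /= Xml'.
- exact: connect0.
exact: toM.
Qed.

Lemma card_hub : #|A| = #|M| + 3.
Proof.
rewrite cardsU cards2 ll' cardsU1 Mx0 (_ : _ :&: _ = set0) ?cards0 /=.
  by rewrite subn0 addnA addnC.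
apply/setP=> z; rewrite in_setI in_set0 in_set2; apply/andP=> -[/orP[]/eqP->];
  exact/negP.
Qed.

(** While [c] stands away from [x0], the center keeps at least four other
neighbors, so the others mix, apart from a tip that [c] cuts off.  This is used
to pave the way of [c] to a fixed leaf [y] with friends. *)
Lemma hub_spider_mixing c legs B :
    4 < #|M| -> size legs < #|M| -> spider_foes c legs B -> #|B| = #|A| ->
  mixing A B.
Proof.
move=> M5 ltM spB cardB.
have pathBc: path_foes (B :\ c) by exact: spider_foes_remove_center spB.
have Bc: c \in B by case: spB => _ -> _; rewrite mem_head.
pose F := [set v in B | edge Y c v].
have F3: 3 <= #|F|.
  rewrite -(leq_add2l (size legs).+1) (leq_trans _ (center_friends_card spB)) //.
  by rewrite cardB card_hub leq_add2r.
have sFB: F \subset B :\ c.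
  apply/subsetP=> v; rewrite !inE => /andP[-> Ycv]; rewrite andbT.
  by apply: contraTneq Ycv => ->; rewrite edge_irr.
have [y] : exists y, y \in M :\ m :\ m'.
  apply/set0Pn; rewrite -card_gt0.
  by apply/leq_cardD1/leq_cardD1/(leq_trans _ M5).
rewrite !inE => /and3P[ym' ym My].
have Ax0: x0 \in A by rewrite !inE eqxx orbT.
have sMA: {subset M <= A} by move=> z Mz; rewrite !inE Mz !orbT.
have Al: l \in A by rewrite !inE eqxx.
have Al': l' \in A by rewrite !inE eqxx orbT.
have MN z : z \in M -> [/\ z != x0, z != l & z != l'].
  move=> Mz; split; first by apply: contraNneq Mx0 => <-.
    by apply: contraNneq Ml => <-; rewrite !inE Mz orbT.
  by apply: contraNneq Ml' => <-; rewrite !inE Mz orbT.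
have [mx0 ml ml'] := MN m M_m; have [m'x0 m'l m'l'] := MN m' M_m'.
have [yx0 yl yl'] := MN y My.
have [lx0 lM] : l != x0 /\ l \notin M by apply/norP; move: Ml; rewrite !inE.
have [l'x0 l'M] : l' != x0 /\ l' \notin M by apply/norP; move: Ml'; rewrite !inE.
(* While c stays on a leaf a, everybody else mixes. *)
have leaf a s : a \in A -> a != x0 -> a != m -> a != m' -> s @: A = B -> s a = c ->
    mixing (A :\ a) (s @: (A :\ a)).
  move=> Aa ax0 am am' sA sac; rewrite perm_im_setD1 sA sac.
  apply: hub_path_mixing => //.
  - exact: subD1set.
  - by rewrite !inE eq_sym ax0 eqxx orbT.
  - by move=> _; rewrite in_setD1 eq_sym am sMA.
  - by move=> _; rewrite in_setD1 eq_sym am' sMA.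
  - apply: leq_trans (leq_cardD1 a M5) _.
    apply/subset_leq_card/subsetP=> z; rewrite in_setD1 in_setI in_setD1.
    by case/andP=> -> Mz; rewrite Mz sMA.
  exact: card_setD1_eq.
(* c walks from z along bs, after friends of c are put there by mixing A'. *)
have stroll z bs A' s : s @: A = B -> s z = c -> z \in A -> z \notin A' -> A' \subset A ->
    path (edge X) z bs -> uniq bs -> {subset bs <= A'} ->
    size bs <= #|F :&: s @: A'| -> mixing A' (s @: A') ->
    exists2 t, shuffle A s t & t (last z bs) = c.
  move=> sA szc Az A'z sA'A Xbs Ubs bsA' leF mixA'.
  have [u [ag uF]] := placement Ubs bsA' leF.
  have sh_su: shuffle A s u by apply: (shuffleS sA'A); exact: mixing_shuffle mixA' erefl ag.
  have uz: u z = c by rewrite -ag.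
  have [|||t sh_ut tE] := @walk A z bs u Xbs.
  - by rewrite /= Ubs andbT; apply: contra A'z => /bsA'.
  - by move=> a; rewrite inE => /predU1P[->//|/bsA'/(subsetP sA'A)].
  - by move=> b /uF; rewrite uz inE => /andP[].
  by exists t; [exact: shuffle_trans sh_su sh_ut | rewrite tE].
have leafF a s : s @: A = B -> s a = c -> F :&: s @: (A :\ a) = F.
  by move=> sA sac; apply/setIidPl; rewrite perm_im_setD1 sA sac.
(* With c on a middle vertex mm, the tip ll is cut off; whoever stands there
   stays, which costs c one of its three friends, and two are needed. *)
have mid mm ll s : (mm, ll) \in [:: (m, l); (m', l')] ->
    s @: A = B -> s mm = c -> exists2 t, shuffle A s t & t y = c.
  move=> mmll sA smc.
  have [Mmm All]: mm \in M /\ ll \in A.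
    by move: mmll; rewrite !inE => /orP[]/eqP[-> ->]; rewrite ?eqxx ?orbT.
  have [xmm xll ymm yll]: [/\ x0 != mm, x0 != ll, y != mm & y != ll].
    by move: mmll; rewrite !inE => /orP[]/eqP[-> ->]; split; rewrite // 1?eq_sym.
  have llM: ll \notin M by move: mmll; rewrite !inE => /orP[]/eqP[_ ->].
  have mml: ll != mm by apply: contraNneq llM => ->.
  have Ymm: edge X mm x0 by rewrite edge_sym XM.
  have cardA': #|A :\ mm :\ ll| = #|B :\ c :\ s ll|.
    apply: card_setD1_eq; rewrite ?in_setD1 ?mml //.
      by rewrite -smc (inj_eq perm_inj) mml -sA imset_f.
    by apply: card_setD1_eq => //; exact: sMA.
  apply: (stroll mm [:: x0; y] (A :\ mm :\ ll)) => //.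
  - exact: sMA.
  - by rewrite !in_setD1 eqxx andbF.
  - by rewrite (subset_trans (subD1set _ _)) // subD1set.
  - by rewrite /= Ymm XM.
  - by rewrite /= inE eq_sym yx0.
  - move=> z; rewrite !inE => /orP[]/eqP->; first by rewrite xmm xll eqxx !orbT.
    by rewrite ymm yll My !orbT.
  - rewrite !perm_im_setD1 sA smc.
    rewrite (_ : F :&: _ = F :\ s ll); first exact: leq_cardD1.
    by rewrite setIDA (setIidPl sFB).
  rewrite !perm_im_setD1 sA smc; apply: hub_path_mixing.
  - by rewrite (subset_trans (subD1set _ _)) // subD1set.
  - by rewrite !in_setD1 xmm xll.
  - move: mmll; rewrite inE mem_seq1 => /orP[]/eqP[-> ->].
      by rewrite in_setD1 eqxx.
    by move=> _; rewrite !in_setD1 ml' mm' sMA.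
  - move: mmll; rewrite inE mem_seq1 => /orP[]/eqP[-> ->].
      by move=> _; rewrite !in_setD1 m'l eq_sym mm' sMA.
    by rewrite in_setD1 eqxx.
  - apply: leq_trans (leq_cardD1 mm M5) _.
    apply/subset_leq_card/subsetP=> z; rewrite in_setD1 in_setI !in_setD1.
    case/andP=> -> Mz; rewrite Mz sMA // !andbT /=; apply: contraTneq Mz => ->.
    by move: mmll; rewrite !inE => /orP[]/eqP[_ ->].
  - exact: path_foesD1.
  exact/esym.
(* The longest walk goes from a tip to y and meets three people. *)
have offhub z s : s @: A = B -> s z = c -> z \in A -> z != x0 ->
    exists2 t, shuffle A s t & t y = c.
  move=> sA szc Az zx0.
  have [zy|zy] := eqVneq z y; first by rewrite -zy; exists s => //; exact: shuffle_refl.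
  have [zm|zm] := eqVneq z m; first by apply: (mid m l); rewrite ?mem_head -?zm.
  have [zm'|zm'] := eqVneq z m'; first by apply: (mid m' l'); rewrite ?inE ?eqxx ?orbT -?zm'.
  have mixz := leaf z s Az zx0 zm zm' sA szc.
  have strollz bs : path (edge X) z bs -> uniq bs -> {subset bs <= A :\ z} ->
      size bs <= 3 -> last z bs = y -> exists2 t, shuffle A s t & t y = c.
    move=> Xbs Ubs bsA le3 <-; apply: (stroll z bs (A :\ z)) => //.
    - by rewrite in_setD1 eqxx.
    - exact: subD1set.
    by rewrite leafF // (leq_trans le3).
  have A'x0: x0 \in A :\ z by rewrite in_setD1 eq_sym zx0.
  have A'y: y \in A :\ z by rewrite in_setD1 eq_sym zy sMA.
  have A'm: m \in A :\ z by rewrite in_setD1 eq_sym zm sMA.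
  have A'm': m' \in A :\ z by rewrite in_setD1 eq_sym zm' sMA.
  have XMC w : w \in M -> edge X w x0 by move=> Mw; rewrite edge_sym XM.
  move: (Az); rewrite !inE -orbA (negPf zx0) /=; case/or3P=> [/eqP zl|/eqP zl|Mz].
  - apply: (strollz [:: m; x0; y]) => //=.
    + by rewrite zl edge_sym Xml XMC ?XM.
    + by rewrite !inE negb_or mx0 eq_sym ym eq_sym yx0.
    by move=> w; rewrite !in_cons in_nil orbF => /or3P[]/eqP->.
  - apply: (strollz [:: m'; x0; y]) => //=.
    + by rewrite zl edge_sym Xml' XMC ?XM.
    + by rewrite !inE negb_or m'x0 eq_sym ym' eq_sym yx0.
    by move=> w; rewrite !in_cons in_nil orbF => /or3P[]/eqP->.
  apply: (strollz [:: x0; y]) => //=.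
  - by rewrite XMC ?XM.
  - by rewrite inE eq_sym yx0.
  by move=> w; rewrite !in_cons in_nil orbF => /orP[]/eqP->.
have home s : s @: A = B -> exists2 t, shuffle A s t & t y = c.
  move=> sA; have /imsetP[z Az /esym szc]: c \in s @: A by rewrite sA.
  have [zx0|zx0] := eqVneq z x0; last exact: (offhub z).
  rewrite {}zx0 {Az} in szc.
  (* x0 has more neighbors than c has foes, so c can step off x0. *)
  have [w Mw Ysw]: exists2 w, w \in M & edge Y c (s w).
    apply/exists_inP; apply: contraLR ltM => /exists_inPn en; rewrite -leqNgt.
    apply: leq_trans (center_foes_card spB).
    rewrite -(card_imset M (@perm_inj _ s)).
    apply/subset_leq_card/subsetP=> _ /imsetP[w Mw ->].
    rewrite inE -sA imset_f ?sMA //= /compl_rel en // andbT -szc (inj_eq perm_inj).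
    by have [] := MN w Mw; rewrite eq_sym.
  have sh1: shuffle A s (tperm x0 w * s).
    by apply: shuffle_swap; rewrite ?szc ?XM //; exact: sMA.
  have [wx0 _ _] := MN w Mw.
  have [||t sh2 ty] := offhub w (tperm x0 w * s) _ _ (sMA w Mw) wx0.
  - by rewrite -sA (agree_off_im sh1.2).
  - by rewrite swapE eqxx (negPf wx0).
  by exists t => //; exact: shuffle_trans sh1 sh2.
move=> s t sA st; have tA: t @: A = B by rewrite -sA (agree_off_im st).
have [s1 [con_s ag_s] s1y] := home s sA; have [t1 [con_t ag_t] t1y] := home t tA.
apply: connect_trans con_s _; rewrite FS_connect_sym; apply: connect_trans con_t _.
have t1A: t1 @: A = B by rewrite -tA (agree_off_im ag_t).
apply: (leaf y t1 (sMA y My)) => // z; rewrite in_setD1 negb_and negbK.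
case/predU1P=> [->|A'z]; first by rewrite s1y.
by rewrite -ag_t // -st // ag_s.
Qed.

End Hub.

(** Padding and sorting the legs reduces the search to the shapes in
[shapes6]. *)
Lemma spider_foes_perm c legs legs' d B :
  perm_eq legs' (legs ++ nseq d [::]) -> spider_foes c legs B -> spider_foes c legs' B.
Proof.
move=> eq_legs [UL BL foeB].
have perm_L: perm_eq (c :: flatten legs') (c :: flatten legs).
  rewrite perm_cons (perm_trans (perm_flatten eq_legs)) // flatten_cat.
  by rewrite (_ : flatten (nseq d [::]) = [::]) ?cats0 //; elim: d {eq_legs}.
split=> [|u|u v Bu Bv /(foeB u v Bu Bv)/hasP[l legs_l cons_uv]].
- by rewrite (perm_uniq perm_L).
- by rewrite (perm_mem perm_L).
by apply/hasP; exists l; rewrite // (perm_mem eq_legs) mem_cat legs_l.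
Qed.

Lemma spider7_mixing x0 m l m' l' y y' c legs B :
    uniq [:: x0; m; l; m'; l'; y; y'] ->
    all (edge X x0) [:: m; m'; y; y'] -> edge X m l -> edge X m' l' ->
    size legs <= 3 -> spider_foes c legs B -> #|B| = 7 ->
  mixing [set z in [:: x0; m; l; m'; l'; y; y']] B.
Proof.
move=> UP /and5P[Xm Xm' Xy Xy' _] Xml Xml' le3 spB cardB.
pose lg := sort (fun l1 l2 => size l2 <= size l1) (legs ++ nseq (3 - size legs) [::]).
have [UL BL foeB]: spider_foes c lg B by apply: spider_foes_perm spB; rewrite perm_sort.
have szL: size (c :: flatten lg) = 7.
  by rewrite -(card_uniqP UL) -cardB; apply: eq_card => z; rewrite -BL.
have srch: search spider2211 (shape lg) 7.
  apply: (allP search_spider2211); apply: sorted_shapes6.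
  - by rewrite size_map size_sort size_cat size_nseq subnKC.
  - by rewrite /shape sorted_map; apply: sort_sorted => l1 l2; exact: leq_total.
  - by rewrite -size_flatten; case: szL.
rewrite (_ : B = [set u in c :: flatten lg]); last by apply/setP=> u; rewrite inE.
apply: (search_mixing (P := [:: x0; m; l; m'; l'; y; y']) (x0 := x0) srch erefl UP szL UL).
  by apply/allP; rewrite /= Xm Xml Xm' Xml' Xy Xy'.
move=> u v; rewrite -!BL => Bu Bv /(foeB u v Bu Bv).
pose g := index^~ (c :: flatten lg).
rewrite -[index u _]/(g u) -[index v _]/(g v).
have: map g (c :: flatten lg) = iota 0 7 by rewrite /g map_index_uniq ?szL.
move: g => g [gc gL].
rewrite -[iota 1 _]gL -map_reshape flattenK /leg_foes has_map.
apply: sub_has => w /= /(consec_map g) /=.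
by rewrite gc.
Qed.

Definition le_spider_foes k B :=
  path_foes B \/ exists c legs, size legs <= k /\ spider_foes c legs B.

(** The alternative [path_foes] in [le_spider_foes] arises when people are left
out: [c] may be among those outside the set [A] from which the growth starts. *)
Lemma spider_mixing k x0 m l m' l' ys :
    2 < k -> connected_graph X -> uniq [:: x0, m, l, m', l' & ys] ->
    (size ys).+1 = k ->
    all (edge X x0) [:: m, m' & ys] -> edge X m l -> edge X m' l' ->
    le_spider_foes k [set: 'I_n] ->
  mixing setT setT.
Proof.
move=> lt2k [_ conX] UP szys Xs Xml Xml' leT.
set A := [set z in [:: x0, m, l, m', l' & ys]].
have cardA: #|A| = k + 4 by rewrite cardsE (card_uniqP UP) /= szys addn4.
have Ax0: x0 \in A by rewrite inE mem_head.
apply: (@mixing_grows (le_spider_foes k) A) => //; rewrite ?cardA.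
- move=> B p [pathB|[c [legs [lek spB]]]] Bp; first by left; exact: path_foesD1.
  have [->|pc] := eqVneq p c; first by left; exact: spider_foes_remove_center spB.
  right; exists c, (map (filter (predC1 p)) legs); split; first by rewrite size_map.
  exact: spider_foesD1.
- move=> B [pathB|[c [legs [lek spB]]]] ltB.
    by apply: path_friends_connected; rewrite // (leq_trans _ ltB) // addn4.
  apply: (spider_friends_connected spB); apply: leq_trans ltB; rewrite addn4.
    by rewrite !ltnS (leq_trans _ lt2k).
  by rewrite !ltnS (leq_trans lek) // -addn3 leq_addr.
- move=> B leB cardB.
  pose M := [set z in [:: m, m' & ys]].
  have defA: A = [set l; l'] :|: (x0 |: M).
    apply/setP=> z; rewrite !inE; case: (z == x0); case: (z == m); case: (z == l);
      by case: (z == m'); case: (z == l').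
  have /and5P[] := UP; rewrite !inE !negb_or.
  case/and5P=> x0m x0l x0m' x0l' x0ys /and4P[ml mm' ml' mys].
  case/and3P=> lm' ll' lys /andP[m'l' m'ys] /andP[l'ys Uys].
  have cardM: #|M| = k.+1.
    rewrite cardsE (card_uniqP _) /= ?szys //.
    by rewrite inE negb_or mm' mys m'ys.
  have Mx0: x0 \notin M by rewrite !inE !negb_or x0m x0m'.
  have Ml: l \notin x0 |: M.
    by rewrite !inE !negb_or (eq_sym l x0) (eq_sym l m) x0l ml lm'.
  have Ml': l' \notin x0 |: M.
    by rewrite !inE !negb_or !(eq_sym l') x0l' ml' m'l'.
  have XM: {in M, forall z, edge X x0 z} by move=> z; rewrite inE => /(allP Xs).
  have M_m: m \in M by rewrite !inE eqxx.
  have M_m': m' \in M by rewrite !inE eqxx orbT.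
  case: leB => [pathB|[c [legs [lek spB]]]].
    rewrite defA in cardA *.
    apply: (hub_path_mixing M_m M_m' XM Xml Xml') => //.
    - by rewrite !inE eqxx orbT.
    - by move=> _; rewrite !inE eqxx !orbT.
    - by move=> _; rewrite !inE eqxx !orbT.
    - by rewrite (setIidPl _) ?cardM ?ltnS // setUA subsetUr.
    by rewrite cardB -cardA.
  have [lt3k|le3k] := ltnP 3 k.
    rewrite defA in cardA *.
    apply: (hub_spider_mixing Mx0 M_m M_m' mm' Ml Ml' ll' XM Xml Xml' _ _ spB);
      by rewrite ?cardM ?ltnS // cardB -cardA.
  have k3: k = 3 by apply/eqP; rewrite eqn_leq le3k.
  rewrite {}k3 in szys cardB lek {lt2k leT cardA cardM le3k x0ys mys lys m'ys l'ys Uys}.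
  case: ys szys UP Xs @A {Ax0 M defA Mx0 Ml Ml' XM M_m M_m'} => [|y [|y' [|]]] // _ UP Xs A.
  exact: (spider7_mixing UP Xs Xml Xml' lek spB cardB).
- apply: (grows_connected (x := x0)) => // a _.
  by rewrite (eq_connect (e' := edge X)) // => u v /=; rewrite inE andbT.
Qed.

End Mixing.

(** * Reading the spiders off the graphs *)

Lemma compl_spider_foes n (Y : sgraph 'I_n) lam :
    graph_iso (compl_graph Y) (spider lam) ->
  exists c legs, size legs = size lam /\ spider_foes Y c legs [set: 'I_n].
Proof.
case=> F [G FK GK] FY.
pose leaf (i : 'I_(size lam)) (j : 'I_(nth 0 lam i)) :=
  G (Some (Tagged (fun i : 'I_(size lam) => 'I_(nth 0 lam i)) j)).
pose leg i := [seq leaf i j | j <- enum 'I_(nth 0 lam i)].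
pose legs := map leg (enum 'I_(size lam)).
have inL v : v \in G None :: flatten legs.
  rewrite -(FK v); case: (F v) => [[i j]|]; rewrite inE ?eqxx //.
  apply/orP; right; apply/allpairsPdep; exists i, j.
  by rewrite !mem_enum.
exists (G None), legs; split; first by rewrite size_map size_enum_ord.
split=> [|v|u v _ _]; rewrite ?inL ?inE //.
  rewrite /= [X in _ && X]allpairs_uniq_dep ?andbT.
  - apply/negP=> /allpairsPdep[i [j [_ _]]].
    by move/(can_inj GK).
  - exact: enum_uniq.
  - by move=> i _; exact: enum_uniq.
  by move=> [i j] [i' j'] _ _ /= /(can_inj GK)[].
have leg_legs i : leg i \in legs by rewrite map_f // mem_enum.
have size_leg i : size (leg i) = nth 0 lam i by rewrite size_map size_enum_ord.
have nth_leg (i : 'I_(size lam)) (j : 'I_(nth 0 lam i)) : nth (G None) (leg i) j = leaf i j.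
  by rewrite (nth_map j) ?size_enum_ord // nth_ord_enum.
have head_leg (i : 'I_(size lam)) (j : 'I_(nth 0 lam i)) : j = 0 :> nat ->
    consec (G None :: leg i) (G None) (leaf i j).
  move=> j0; rewrite -nth_leg j0.
  apply: (@consec_nth _ _ (G None :: leg i) 0).
  by rewrite /= size_leg ltnS (leq_ltn_trans _ (ltn_ord j)).
have next_leg (i : 'I_(size lam)) (j j' : 'I_(nth 0 lam i)) : j.+1 = j' ->
    consec (G None :: leg i) (leaf i j) (leaf i j').
  move=> jj'; rewrite -!nth_leg -jj'.
  by apply: (@consec_nth _ _ (G None :: leg i) j.+1); rewrite /= size_leg ltnS jj'.
have := FY u v; rewrite /= => <-; rewrite -{2}(FK u) -{2}(FK v).
case: (F u) (F v) => [[i j]|] [[i' j']|] //=.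
- case/andP=> /eqP eq_i; case: _ / eq_i j' => j' /orP[]/eqP jj';
    apply/hasP; exists (leg i) => //.
    exact: next_leg.
  by rewrite consecC; exact: next_leg.
- by move/eqP=> j0; apply/hasP; exists (leg i) => //; rewrite consecC; exact: head_leg.
by move/eqP=> j0; apply/hasP; exists (leg i') => //; exact: head_leg.
Qed.

(** Coordinates of the vertices by plain numbers, which avoids the dependent
types of the legs when vertices are listed and compared. *)
Definition label lam (v : spider_vertex lam) : option (nat * nat) :=
  if v is Some p then Some (nat_of_ord (tag p), nat_of_ord (tagged p)) else None.

Definition label_rel : rel (option (nat * nat)) := fun p q =>
  match p, q with
  | None, Some (_, j) | Some (_, j), None => j == 0
  | Some (i, j), Some (i', j') => (i == i') && ((j.+1 == j') || (j'.+1 == j))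
  | None, None => false
  end.

Lemma contains_spider_mixing n (X Y : sgraph 'I_n) k :
    2 < k -> connected_graph X ->
    contains_subgraph X (spider [:: 2, 2 & nseq (k - 1) 1]) ->
    le_spider_foes Y k [set: 'I_n] ->
  mixing X Y setT setT.
Proof.
move=> lt2k conX [f finj fX] leY.
set lam := [:: 2, 2 & _] in f finj fX.
pose g p : 'I_n := f (odflt None [pick v : spider_vertex lam | label v == p]).
pose lab_ok (p : option (nat * nat)) :=
  if p is Some (i, j) then (i < size lam) && (j < nth 0 lam i) else true.
have gP p : lab_ok p -> exists2 v, label v = p & g p = f v.
  move=> okp; rewrite /g; case: pickP => [v /eqP <- /=|none]; first by exists v.
  case: p okp none => [[i j] /= /andP[lti ltj]|_] none; last by have := none None.
  by have /eqP[] := none (Some (Tagged (fun i : 'I_(size lam) => 'I_(nth 0 lam i))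
       (i := Ordinal lti) (Ordinal ltj))).
have g_inj : {in lab_ok &, injective g}.
  move=> p q /gP[v <- ->] /gP[w <- ->].
  by move/finj->.
have gX p q : lab_ok p -> lab_ok q -> label_rel p q -> edge X (g p) (g q).
  move=> /gP[v <- ->] /gP[w <- ->] vw; apply: fX.
  by case: v w vw => [[i j]|] [[i' j']|].
pose ys := [seq Some (i, 0) | i <- iota 2 (k - 1)].
have ok_ys p : p \in ys -> lab_ok p.
  case/mapP=> i; rewrite mem_iota => /andP[le2i lti] ->.
  rewrite /= size_nseq lti; case: i le2i lti => [|[|i]] //= _.
  by move=> lti; rewrite nth_nseq (lti : i < k - 1).
apply: (@spider_mixing n X Y k (g None) (g (Some (0, 0))) (g (Some (0, 1)))
          (g (Some (1, 0))) (g (Some (1, 1))) (map g ys)) => //.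
- set P := [:: None, Some (0, 0), Some (0, 1), Some (1, 0), Some (1, 1) & ys].
  rewrite -[X in uniq X]/(map g P) map_inj_in_uniq.
    rewrite /= !inE /= map_inj_uniq ?iota_uniq ?andbT; last by move=> i j [].
    do ![apply/andP; split] => //; apply/negP=> /mapP[i];
      by rewrite mem_iota => /andP[le2i _] [] // ei; rewrite -ei in le2i.
  have okP p : p \in P -> lab_ok p.
    by rewrite !inE => /or4P[/eqP->|/eqP->|/eqP->|/or3P[/eqP->|/eqP->|/ok_ys]].
  by move=> p q /okP okp /okP; exact: g_inj.
- by rewrite !size_map size_iota subn1 prednK // (leq_trans _ lt2k).
- rewrite /= !gX //=; apply/allP=> _ /mapP[p ys_p ->].
  by apply: gX; [|exact: ok_ys|case/mapP: ys_p => i _ ->].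
- exact: gX.
- exact: gX.
Qed.

Theorem theorem4p7 (k n : nat) (X Y : sgraph 'I_n) :
  3 <= k ->
  connected_graph X ->
  contains_subgraph X (spider [:: 2, 2 & nseq (k - 1) 1]) ->
  (exists2 m : nat, m <= k & spider_with_legs (compl_graph Y) m) ->
  connected_graph (FS X Y).
Proof.
move=> lt2k conX Xspider [r lek [lam [szr _ _ /compl_spider_foes[c [legs [szl spY]]]]]].
split; first by apply/card_gt0P; exists 1%g.
have mixT: mixing X Y setT setT.
  apply: contains_spider_mixing lt2k conX Xspider _.
  by right; exists c, legs; rewrite szl szr.
move=> s t; apply: mixT => [|x]; last by rewrite inE.
by apply/setP=> x; rewrite mem_perm_im !inE.
Qed.
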